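(* Let $\mathcal{A}=\{V(f_1),\ldots,V(f_k)\}$ be an essential real hyperplane arrangement in $\mathbb{R}^n$ (each $f_i\in\mathbb{R}[x_1,\dots,x_n]$ of degree one). Let $g\in\mathbb{R}[x_1,\dots,x_n]$ be a generic polynomial of degree two satisfying $g(x)>0$ for all $x\in\mathbb{R}^n$. Then for the function $$\psi(x)=\sum_{i=1}^k u_i\log|f_i(x)| - v\log|g(x)|,$$ where $u_1,\ldots,u_k,v\in\mathbb{R}_{>0}$ and $2v>\sum_{i=1}^k u_i$, all (complex) critical points of $\psi$ are real, and there is precisely one critical point in each region of $\mathbb{R}^n\setminus\mathcal{A}$.
   Context: The arrangement $\mathcal{A}$ is essential if the normal vectors of the hyperplanes $V(f_1),\dots,V(f_k)$ span an $n$-dimensional space. $\mathbb{R}^n\setminus\mathcal{A}$ is the complement of the union of the hyperplanes; its regions are its connected components. The (complex) critical points of $\psi$ are the points $x\in\mathbb{C}^n$ with $g(x)\prod_i f_i(x)\neq 0$ satisfying $\sum_{i=1}^k u_i\frac{1}{f_i(x)}\frac{\partial f_i}{\partial x_j}(x)-v\frac{1}{g(x)}\frac{\partial g}{\partial x_j}(x)=0$ for $j=1,\dots,n$. ''Generic'' for $g$ means: $g$ lies outside a suitable proper Zariski closed subset (depending on $\mathcal{A}$) of the space of real polynomials of degree at most two. *)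

(* Defs.v *)
From HB Require Import structures.
From mathcomp Require Import all_boot all_order all_algebra.
From mathcomp Require Import all_classical all_reals all_analysis.
From mathcomp Require Import complex.
(* The notations of multinomials and of MathComp-Analysis have clashing levels. *)
From mathcomp Require Import -(notations) mpoly.

Set Implicit Arguments.
Unset Strict Implicit.
Unset Printing Implicit Defensive.

Import Order.TTheory GRing.Theory Num.Theory.
Import numFieldNormedType.Exports.

Local Open Scope classical_set_scope.
Local Open Scope ring_scope.

Notation "{ 'mpoly' R [ n ] }" := (mpoly n R) : type_scope.

(* [mpoly.msize p] is the total degree of [p] plus one, and 0 if [p = 0]. *)
Definition has_degree (R : realType) (n d : nat) (p : {mpoly R[n]}) : Prop :=
  mpoly.msize p = d.+1.

Definition evalR (R : realType) (n : nat) (p : {mpoly R[n]}) (x : 'rV[R]_n) : R :=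
  meval (fun j => x 0 j) p.

Definition evalC (R : realType) (n : nat) (p : {mpoly R[n]})
    (z : 'rV[complex R]_n) : complex R :=
  meval (fun j => z 0 j) (map_mpoly (real_complex R) p).

Definition toC (R : realType) (n : nat) (x : 'rV[R]_n) : 'rV[complex R]_n :=
  map_mx (real_complex R) x.

Definition hyperplane (R : realType) (n : nat) (f : {mpoly R[n]}) : set 'rV[R]_n :=
  [set x | evalR f x = 0].

Definition arr_complement (R : realType) (n k : nat) (f : 'I_k -> {mpoly R[n]}) :
    set 'rV[R]_n :=
  ~` \bigcup_(i in [set: 'I_k]) hyperplane (f i).

Definition is_region (R : realType) (n k : nat) (f : 'I_k -> {mpoly R[n]})
    (C : set 'rV[R]_n) : Prop :=
  exists2 x, arr_complement f x & C = connected_component (arr_complement f) x.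

(* Row [i] is the normal vector of [hyperplane (f i)]: the coefficients of the
   linear part of [f i]. *)
Definition normals (R : realType) (n k : nat) (f : 'I_k -> {mpoly R[n]}) : 'M[R]_(k, n) :=
  \matrix_(i < k, j < n) mcoeff (mnm1 j) (f i).

Definition essential (R : realType) (n k : nat) (f : 'I_k -> {mpoly R[n]}) : Prop :=
  \rank (normals f) = n.

(* [critical_point f g u v z] says that [z] is a complex critical point of
     psi(x) = \sum_i u_i log |f_i(x)| - v log |g(x)|,
   whose partial derivatives are the rational functions below. *)
Definition critical_point (R : realType) (n k : nat) (f : 'I_k -> {mpoly R[n]})
    (g : {mpoly R[n]}) (u : 'I_k -> R) (v : R) (z : 'rV[complex R]_n) : Prop :=
  evalC g z * \prod_(i < k) evalC (f i) z != 0 /\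
  forall j : 'I_n,
    \sum_(i < k) real_complex R (u i) * (evalC (f i) z)^-1 * evalC (mderiv j (f i)) z
    - real_complex R v * (evalC g z)^-1 * evalC (mderiv j g) z = 0.

Definition deg_le2 (R : realType) (n : nat) : set {mpoly R[n]} :=
  [set g | (mpoly.msize g <= 3)%N].

(* [bmultinom n 3] is the finite type of the exponents of total degree < 3, so
   the coefficients indexed by it are linear coordinates on [deg_le2 R n]. *)
Definition coefs2 (R : realType) (n : nat) (g : {mpoly R[n]}) :
    'I_#|{: bmultinom n 3}| -> R :=
  fun i => mcoeff (bmnm (enum_val i)) g.

Definition zariski_closed2 (R : realType) (n : nat) (Z : set {mpoly R[n]}) : Prop :=
  exists S : set {mpoly R[#|{: bmultinom n 3}|]},
    Z = [set g | deg_le2 g /\ forall P, S P -> meval (coefs2 g) P = 0].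

(* Main.v *)
(* Homogenizing with respect to the hyperplane at infinity, which gets the weight
   w_0 = 2 v - \sum_i u_i > 0, turns [g] into a positive semidefinite quadratic form Q
   on R^(n+1), and critical points into solutions X of
     \sum_i w_i A_i / <A_i, X> = Q X,
   where the A_i are the homogenized linear forms.  Pairing the difference of the
   equations of two solutions X and Y with X - Y gives
     \sum_i w_i <A_i, X - Y> ^ 2 / (<A_i, X> <A_i, Y>) + Q (X - Y) = 0.
   With Y the conjugate of X, X - Y is 2 i times a real vector and all denominators
   are positive, so that the imaginary part of X vanishes; with X and Y real and in
   the same region the denominators are positive too, so that X = Y.
   If moreover the quadratic part of [g] is nondegenerate, it is positive definite, and
   2 v > \sum_i u_i makes psi tend to -oo at the boundary of each region and at
   infinity, so that psi has a maximum there; the only genericity needed is thus the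
   nonvanishing of the determinant of the Hessian of [g]. *)
Require Import Defs.
From HB Require Import structures.
From mathcomp Require Import all_boot all_order all_algebra.
From mathcomp Require Import all_classical all_reals all_analysis.
From mathcomp Require Import complex.
From mathcomp Require Import ring lra.
From mathcomp Require Import -(notations) mpoly.

Set Implicit Arguments.
Unset Strict Implicit.
Unset Printing Implicit Defensive.

Import Order.TTheory GRing.Theory Num.Theory.
Import numFieldNormedType.Exports.

Local Open Scope classical_set_scope.
Local Open Scope ring_scope.

(** * Polynomials of degree at most two *)

Lemma mpoly_affine (R : comNzRingType) (n : nat) (p : {mpoly R[n]}) :
  (mpoly.msize p <= 2)%N ->
  p = mpolyC n (mcoeff mnm0 p) + \sum_(j < n) mcoeff (mnm1 j) p *: mpolyX R (mnm1 j).
Proof.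
move=> hp; apply/mpolyP => m; rewrite mcoeffD mcoeffC raddf_sum /=.
under eq_bigr => j _ do rewrite mcoeffZ mcoeffX.
have [->|m0] := eqVneq m mnm0.
  by rewrite mulr1 big1 ?addr0// => j _; rewrite mnm1_eq0 mulr0.
rewrite mulr0 add0r; have [m1|m1] := boolP (mdeg m == 1%N).
  have /mdeg1P[i /eqP ->] := m1.
  rewrite (bigD1 i)//= eqxx mulr1 big1 ?addr0// => j ji.
  by rewrite eq_mnm1 (negbTE ji) mulr0.
rewrite big1 => [|j _].
  apply: memN_msupp_eq0; apply: msize_mdeg_ge.
  by apply: leq_trans hp _; rewrite ltn_neqAle eq_sym m1 lt0n mdeg_eq0.
by have [jm|] := eqVneq; [move: m1; rewrite -jm mdeg1 | rewrite mulr0].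
Qed.

(** Euler's identity on each homogeneous part: the sum of the [x_j d_j] multiplies the part of
    degree [d] by [d]. The constant terms of the derivatives count the linear part once more, so
    that degrees one and two both get the factor 2. *)
Lemma mpoly_euler2 (R : comNzRingType) (n : nat) (p : {mpoly R[n]}) :
  (mpoly.msize p <= 3)%N ->
  p *+ 2 = mpolyC n (mcoeff mnm0 p) *+ 2 +
    \sum_(j < n) mpolyX R (mnm1 j) *
      (mderiv j p + mpolyC n (mcoeff mnm0 (mderiv j p))).
Proof.
move=> hp; pose L (q : {mpoly R[n]}) := mpolyC n (mcoeff mnm0 q) *+ 2 +
    \sum_(j < n) mpolyX R (mnm1 j) *
      (mderiv j q + mpolyC n (mcoeff mnm0 (mderiv j q))).
(* The right-hand side is linear in the polynomial, so that monomials suffice. *)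
have LD q r : L (q + r) = L q + L r.
  rewrite /L mcoeffD mpolyCD mulrnDl [RHS]addrACA -big_split; congr (_ + _).
  apply: eq_bigr => j _; rewrite -[RHS]mulrDr mderivD mcoeffD mpolyCD; congr (_ * _).
  by rewrite [RHS]addrACA.
have LZ a q : L (a *: q) = a *: L q.
  rewrite /L scalerDr mcoeffZ mpolyCM mul_mpolyC scalerMnr scaler_sumr.
  congr (_ + _); apply: eq_bigr => j _.
  by rewrite !mderivZ mcoeffZ mpolyCM mul_mpolyC -scalerDr scalerAr.
have L0 : L 0 = 0 by rewrite -(scale0r 0) LZ !scale0r.
rewrite -/(L p) {2}[p]mpolyE {1}[p]mpolyE (big_morph L LD L0) -sumrMnl.
apply: eq_big_seq => m /msize_mdeg_lt /leq_trans /(_ hp) mlt3.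
rewrite LZ scalerMnr; congr (_ *: _).
rewrite /L.
under eq_bigr => j _ do rewrite mderivX mcoeffZ mcoeffX mpolyCM mul_mpolyC
   -scalerDr -scalerAr.
have Xsub j : m j != 0%N -> mnm_add (mnm1 j) (mnm_sub m (mnm1 j)) = m.
  by move=> mj; rewrite addmC submK// lep1mP.
rewrite mcoeffX.
have [->|m0] := eqVneq m mnm0.
  by rewrite big1 ?addr0 ?mpolyX0// => j _; rewrite mnm0E scale0r.
rewrite mpolyC0 mul0rn add0r.
have [/mdeg1P[i /eqP ->]|m1] := boolP (mdeg m == 1%N).
  rewrite (bigD1 i)//= big1 ?addr0 => [|j ji].
    rewrite mnm1E eqxx scale1r.
    have -> : mnm_sub (mnm1 i) (mnm1 i) = @mnm0 n.
      by apply/mnmP => j; rewrite mnmBE subnn mnm0E.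
    by rewrite eqxx mpolyX0 mpolyC1 mulrDr mulr1 mulr2n.
  by rewrite mnm1E eq_sym (negbTE ji) scale0r.
(* In degree two, the factor 2 is the sum of the exponents [m j] that the derivatives produce. *)
have m2 : (\sum_(j < n) m j = 2)%N.
  apply/eqP; rewrite -mdegE eqn_leq -ltnS mlt3 /=.
  by rewrite ltn_neqAle eq_sym m1 lt0n mdeg_eq0.
rewrite -[in LHS]m2 -sumrMnr; apply: eq_bigr => j _.
have [->|mj] := eqVneq (m j) 0%N; first by rewrite scale0r mulr0n.
rewrite mulrDr -mpolyXD Xsub//.
have [mj0|_] := eqVneq (mnm_sub m (mnm1 j)) mnm0.
  by move: m1; rewrite -(Xsub _ mj) mj0 mdegD mdeg1 mdeg0.
by rewrite mpolyC0 mulr0 addr0 scaler_nat.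
Qed.

Lemma msize_mderiv (R : comNzRingType) (n d : nat) (p : {mpoly R[n]}) (j : 'I_n) :
  (mpoly.msize p <= d.+1)%N -> (mpoly.msize (mderiv j p) <= d)%N.
Proof.
move=> hp; rewrite msizeE; apply/bigmax_leqP_seq => m + _.
rewrite mcoeff_msupp mcoeff_deriv => m0.
have /msize_mdeg_lt : mnm_add m (mnm1 j) \in msupp p.
  by rewrite mcoeff_msupp; apply: contraNneq m0 => ->; rewrite mul0rn.
by rewrite mdegD mdeg1 addn1 => /leq_trans/(_ hp).
Qed.

Lemma mcoeff0_mderiv (R : comNzRingType) (n : nat) (p : {mpoly R[n]}) (j : 'I_n) :
  mcoeff mnm0 (mderiv j p) = mcoeff (mnm1 j) p.
Proof. by rewrite mcoeff_deriv mnm0E mulr1n add0m. Qed.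

(** * Values and gradients at complex points *)

Lemma evalCD (R : realType) (n : nat) (p q : {mpoly R[n]}) (z : 'rV[complex R]_n) :
  evalC (p + q) z = evalC p z + evalC q z.
Proof. by rewrite /evalC !raddfD. Qed.

Lemma evalC_toC (R : realType) (n : nat) (p : {mpoly R[n]}) (x : 'rV[R]_n) :
  evalC p (toC x) = real_complex R (evalR p x).
Proof.
elim/mpolyind: p => [|c m p _ _ IH].
  by rewrite /evalC /evalR raddf0 !meval0 rmorph0.
rewrite evalCD IH {1}/evalC {2}/evalR mevalD map_mpolyZ map_mpolyX !mevalZ !mevalX.
rewrite [RHS]rmorphD [X in _ = X + _]rmorphM; congr (_ * _ + _).
rewrite [RHS]rmorph_prod; apply: eq_bigr => i _.
by rewrite [RHS]rmorphXn [toC x 0 i]mxE.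
Qed.

Lemma evalC_sum (R : realType) (n m : nat) (F : 'I_m -> {mpoly R[n]})
    (z : 'rV[complex R]_n) :
  evalC (\sum_i F i) z = \sum_i evalC (F i) z.
Proof.
by apply: (big_morph (fun p => evalC p z)) => [p q|]; rewrite ?evalCD// /evalC !raddf0.
Qed.

Lemma evalC_affine (R : realType) (n : nat) (p : {mpoly R[n]}) (z : 'rV[complex R]_n) :
  (mpoly.msize p <= 2)%N ->
  evalC p z = real_complex R (mcoeff mnm0 p) +
    \sum_(j < n) z 0 j * real_complex R (mcoeff (mnm1 j) p).
Proof.
move=> /mpoly_affine {1}->.
rewrite evalCD evalC_sum {1}/evalC map_mpolyC mevalC; congr (_ + _).
by apply: eq_bigr => j _; rewrite /evalC map_mpolyZ map_mpolyX mevalZ mevalXU mulrC.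
Qed.

Lemma evalC_mderiv_affine (R : realType) (n : nat) (p : {mpoly R[n]})
    (z : 'rV[complex R]_n) (j : 'I_n) :
  (mpoly.msize p <= 2)%N ->
  evalC (mderiv j p) z = real_complex R (mcoeff (mnm1 j) p).
Proof.
move=> /(msize_mderiv j) /msize1_polyC {1}->.
by rewrite /evalC map_mpolyC mevalC mcoeff0_mderiv.
Qed.

Lemma evalC_euler2 (R : realType) (n : nat) (p : {mpoly R[n]}) (z : 'rV[complex R]_n) :
  (mpoly.msize p <= 3)%N ->
  evalC p z *+ 2 = real_complex R (mcoeff mnm0 p) *+ 2 +
    \sum_(j < n) z 0 j *
      (evalC (mderiv j p) z + real_complex R (mcoeff mnm0 (mderiv j p))).
Proof.
move=> /mpoly_euler2 E.
have evalCMn q : evalC q z *+ 2 = evalC (q *+ 2) z by rewrite !mulr2n evalCD.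
rewrite evalCMn E evalCD -evalCMn evalC_sum {1}/evalC map_mpolyC mevalC; congr (_ + _).
apply: eq_bigr => j _; rewrite /evalC rmorphM rmorphD /= map_mpolyX map_mpolyC.
by rewrite mevalM mevalD mevalXU mevalC.
Qed.

(** In degree at most two the second derivatives are constant, so that their constant terms give the
    Hessian at every point. *)
Definition hessian (R : realType) (n : nat) (g : {mpoly R[n]}) : 'M[R]_n :=
  \matrix_(i, j) mcoeff mnm0 (mderiv i (mderiv j g)).

Definition gradient0 (R : realType) (n : nat) (g : {mpoly R[n]}) : 'rV[R]_n :=
  \row_j mcoeff mnm0 (mderiv j g).

Lemma evalC_mderiv_quadratic (R : realType) (n : nat) (g : {mpoly R[n]})
    (z : 'rV[complex R]_n) (j : 'I_n) :
  (mpoly.msize g <= 3)%N ->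
  evalC (mderiv j g) z = real_complex R (gradient0 g 0 j) +
    (z *m map_mx (real_complex R) (hessian g)) 0 j.
Proof.
move=> hg; rewrite evalC_affine ?msize_mderiv// !mxE; congr (_ + _).
by apply: eq_bigr => i _; rewrite !mxE mcoeff0_mderiv.
Qed.

(** * Homogenization *)

(** Coordinate 0 is the homogenizing variable. Row 0 is the form of the hyperplane at infinity, and
    row [1 + i] is the homogenization of [f i]. *)
Definition homog_forms (R : realType) (n k : nat) (f : 'I_k -> {mpoly R[n]}) :
    'M[R]_(1 + k, 1 + n) :=
  block_mx 1%:M 0 (\col_i mcoeff mnm0 (f i)) (normals f).

(** For [g] of degree at most two, this is the Gram matrix of twice its homogenization: the form
    takes the value [2 g(x)] at [(1, x)]. *)
Definition homog_quad (R : realType) (n : nat) (g : {mpoly R[n]}) : 'M[R]_(1 + n) :=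
  block_mx (mcoeff mnm0 g *+ 2)%:M (gradient0 g) (gradient0 g)^T (hessian g).

(** Pairing the homogenized equation with its solution [X] shows that the weights add up to the
    value of the quadratic form at [X]. The weight at infinity makes this total [2 v]. *)
Definition homog_weights (R : realType) (k : nat) (u : 'I_k -> R) (v : R) :
    'rV[R]_(1 + k) :=
  row_mx (2 * v - \sum_i u i)%:M (\row_i u i).

Lemma homog_formsE (R : realType) (n k : nat) (f : 'I_k -> {mpoly R[n]})
    (z : 'rV[complex R]_n) (mu : complex R) :
  (forall i, mpoly.msize (f i) <= 2)%N ->
  row_mx mu%:M (mu *: z) *m (map_mx (real_complex R) (homog_forms f))^T =
  row_mx mu%:M (mu *: \row_i evalC (f i) z).
Proof.
move=> f_deg1; rewrite map_block_mx tr_block_mx mul_row_block; congr row_mx.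
  by rewrite map_mx1 map_mx0 trmx1 trmx0 mulmx1 mulmx0 addr0.
apply/rowP => i; rewrite !mxE evalC_affine// mulrDr mulr_sumr big_ord1 !mxE mulr1n.
by congr (_ + _); apply: eq_bigr => j _; rewrite !mxE mulrA.
Qed.

(* A critical point [z] lifts to [mu (1, z)] in the homogenized arrangement, with
   [mu ^+ 2 = v / g z] and weight [2 v - \sum_i u i] on the hyperplane at infinity. *)
Lemma critical_point_homog (R : realType) (n k : nat) (f : 'I_k -> {mpoly R[n]})
    (g : {mpoly R[n]}) (u : 'I_k -> R) (v : R) (z : 'rV[complex R]_n) (mu : complex R) :
  let C := real_complex R in
  let X := row_mx mu%:M (mu *: z) : 'rV_(1 + n) in
  (forall i, mpoly.msize (f i) <= 2)%N -> (mpoly.msize g <= 3)%N ->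
  critical_point f g u v z -> mu != 0 -> mu ^+ 2 = C v / evalC g z ->
  (\row_i (C (homog_weights u v 0 i) / (X *m (map_mx C (homog_forms f))^T) 0 i))
    *m map_mx C (homog_forms f) = X *m map_mx C (homog_quad g).
Proof.
move=> C X hf hg [nz crit] mu0 mu2.
move: nz; rewrite mulf_eq0 negb_or => /andP[gz0 /prodf_neq0 fz0].
rewrite homog_formsE//.
have -> : \row_i (C (homog_weights u v 0 i) /
    (row_mx mu%:M (mu *: \row_i evalC (f i) z) : 'rV_(1 + k)) 0 i) =
    row_mx (C (2 * v - \sum_i u i) / mu)%:M (\row_i (C (u i) / (mu * evalC (f i) z))).
  apply/rowP => i; rewrite mxE /homog_weights.
  by case: (split_ordP i) => l ->; rewrite ?row_mxEl ?row_mxEr !mxE // ?ord1 ?eqxx ?mulr1n.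
rewrite /X /homog_forms /homog_quad !map_block_mx !mul_row_block.
have fE i : evalC (f i) z != 0 by apply: fz0.
(* The gradient of an affine form is its normal vector, and [v / g] is [mu ^+ 2]. *)
have critj j : \sum_(i < k) C (u i) / evalC (f i) z * C (normals f i j) =
    mu ^+ 2 * evalC (mderiv j g) z.
  rewrite mu2; apply: (etrans _ (subr0_eq (crit j))).
  by apply: eq_bigr => i _; rewrite evalC_mderiv_affine// mxE.
congr row_mx; apply: (scalerI mu0).
(* Coordinate 0: writing the constant term of [f i] as [f i] minus its linear part cancels the
   weights [u i] and leaves [2 v] minus the pairing of [z] with the left sides of [critj]. *)
- apply/rowP => j; rewrite (ord1 j) {j} !mxE !big_ord1 !mxE !eqxx !mulr1n.
  rewrite [C 1]rmorph1 mulr1.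
  rewrite !mulrDr mulrCA divff// mulr1 !mulr_sumr.
  have -> : \sum_(i < k) mu * ((\row_i (C (u i) / (mu * evalC (f i) z))) 0 i *
      (map_mx C (\col_i mcoeff mnm0 (f i))) i 0) =
      \sum_(i < k) (C (u i) - C (u i) / evalC (f i) z *
        \sum_(j < n) z 0 j * C (normals f i j)).
    apply: eq_bigr => i _; rewrite !mxE.
    have -> : C (mcoeff mnm0 (f i)) = evalC (f i) z - \sum_(j < n) z 0 j * C (normals f i j).
      rewrite evalC_affine//; under [X in _ - X]eq_bigr => j _ do rewrite mxE.
      by rewrite addrK.
    by field; rewrite mu0 fE.
  (* Euler's identity trades the linear part of [g] for [g] itself and its gradient. *)
  have -> : \sum_(j < n) mu * ((mu *: z) 0 j * (map_mx C (gradient0 g)^T) j 0) =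
      mu ^+ 2 * (evalC g z *+ 2 - C (mcoeff mnm0 g) *+ 2) -
      \sum_(j < n) z 0 j * (mu ^+ 2 * evalC (mderiv j g) z).
    rewrite (evalC_euler2 _ hg) addrAC subrr add0r mulr_sumr -sumrB.
    by apply: eq_bigr => j _; rewrite !mxE; ring.
  rewrite sumrB.
  under [X in _ = _ + (_ - X)]eq_bigr => j _ do rewrite -critj mulr_sumr.
  rewrite exchange_big /=.
  have -> : \sum_(i < k) \sum_(j < n)
      z 0 j * (C (u i) / evalC (f i) z * C (normals f i j)) =
      \sum_(i < k) C (u i) / evalC (f i) z * \sum_(j < n) z 0 j * C (normals f i j).
    by apply: eq_bigr => i _; rewrite mulr_sumr; apply: eq_bigr => j _; rewrite mulrCA.
  rewrite [C (_ - _)]rmorphB [C (_ *+ _)]rmorphMn rmorphM rmorph_sum.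
  rewrite /= -/C addrA subrK addrA; congr (_ - _).
  have -> : C 2 = 2 by exact: rmorph_nat.
  rewrite -mulr_natr -[evalC g z *+ 2]mulr_natr -[C _ *+ 2]mulr_natr.
  transitivity (mu ^+ 2 * evalC g z * 2); last by ring.
  by rewrite mu2; field.
(* After the scaling by [mu], the other coordinates are the equations [critj]. *)
- apply/rowP => j; rewrite map_mx0 mulmx0 add0r -scalemxAl.
  rewrite !mxE big_ord1 !mxE eqxx mulr1n.
  transitivity (mu * (mu * evalC (mderiv j g) z)); last first.
    rewrite evalC_mderiv_quadratic// !mxE mulrDr mulr_sumr; congr (_ * (_ + _)).
  rewrite [RHS]mulrA -expr2 -critj mulr_sumr.
  apply: eq_bigr => i _; rewrite !mxE; field.
  by rewrite fE mu0.
Qed.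

(** Pairing the difference of the two equations with the real vector [d] and cancelling [e] equates
    a sum of nonnegative terms with minus the value of [Q] at [d], so that each term vanishes. The
    scalar [e] lets one argument serve conjugate points, with [e = 2 i], and real points, with
    [e = 1]. *)
Lemma stationary_unique (R : rcfType) (k m : nat) (A : 'M[R]_(k, m)) (Q : 'M[R]_m)
    (w : 'I_k -> R) (X Y : 'rV[complex R]_m) (e : complex R) (d : 'rV[R]_m) :
  let C := real_complex R in
  let F X := X *m (map_mx C A)^T in
  let stationary X :=
    (\row_i (C (w i) / F X 0 i)) *m map_mx C A = X *m map_mx C Q in
  (forall x : 'rV[R]_m, 0 <= (x *m Q *m x^T) 0 0) ->
  (forall x : 'rV[R]_m, x *m A^T = 0 -> x = 0) ->
  (forall i, 0 < w i) ->
  stationary X -> stationary Y ->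
  e != 0 -> X - Y = e *: map_mx C d ->
  (forall i, 0 < F X 0 i * F Y 0 i) -> d = 0.
Proof.
move=> C F stationary Qge0 A_inj w_gt0 sX sY e0 XY FXY.
apply: A_inj; apply/rowP => i; rewrite [RHS]mxE.
pose D := d *m A^T.
have FB j : F X 0 j - F Y 0 j = e * C (D 0 j).
  have -> : F X 0 j - F Y 0 j = (F X - F Y) 0 j by rewrite !mxE.
  by rewrite /F -mulmxBl XY -scalemxAl mxE map_trmx -map_mxM mxE.
have rowB (a b : 'I_k -> complex R) j : (\row_i a i - \row_i b i) 0 j = a j - b j.
  by rewrite !mxE.
have F0 j : F X 0 j != 0 /\ F Y 0 j != 0.
  by apply/andP; rewrite -negb_or -mulf_eq0 gt_eqF.
pose T j := C (w j) * C (D 0 j) ^+ 2 / (F X 0 j * F Y 0 j).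
have T_ge0 j : 0 <= T j.
  rewrite /T mulr_ge0 ?invr_ge0 ?(ltW (FXY _))// -rmorphXn -rmorphM /=.
  by rewrite ler0c mulr_ge0 ?sqr_ge0 ?(ltW (w_gt0 _)).
have : (\row_i (C (w i) / F X 0 i) - \row_i (C (w i) / F Y 0 i)) *m
    map_mx C A *m (map_mx C d)^T = (X - Y) *m map_mx C Q *m (map_mx C d)^T.
  by rewrite !mulmxBl sX sY.
rewrite XY -!scalemxAl -mulmxA -[map_mx C A]trmxK -trmx_mul map_trmx -map_mxM.
rewrite -/D map_trmx -!map_mxM => /matrixP/(_ 0 0).
rewrite mxE [in RHS]mxE [in X in _ = _ * X]mxE.
have -> : \sum_j (\row_i (C (w i) / F X 0 i) - \row_i (C (w i) / F Y 0 i)) 0 j *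
    (map_mx C D)^T j 0 = - e * \sum_j T j.
  rewrite mulr_sumr; apply: eq_bigr => j _.
  have [FX0 FY0] := F0 j.
  rewrite rowB [(map_mx C D)^T j 0]mxE [map_mx C D 0 j]mxE -mulrBr.
  have -> : (F X 0 j)^-1 - (F Y 0 j)^-1 = - (e * C (D 0 j)) / (F X 0 j * F Y 0 j).
    by rewrite -FB; field; rewrite FX0 FY0.
  by rewrite /T; field; rewrite FX0 FY0.
rewrite mulNr -mulrN => /(mulfI e0) eT.
have T0 : \sum_j T j = 0.
  apply/eqP; rewrite eq_le sumr_ge0// andbT -oppr_ge0 eT ler0c.
  exact: Qge0.
have /eqP := T0; rewrite psumr_eq0// => /allP/(_ i (mem_index_enum i)) /= /eqP.
have [FX0 FY0] := F0 i.
move/eqP; rewrite /T !mulf_eq0 invr_eq0 mulf_eq0 (negbTE FX0) (negbTE FY0) !orbF.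
by rewrite ?sqrf_eq0 ?orbb !fmorph_eq0 gt_eqF//= => /eqP.
Qed.

(** * Positivity *)

Lemma evalR_affine (R : realType) (n : nat) (p : {mpoly R[n]}) (x : 'rV[R]_n) :
  (mpoly.msize p <= 2)%N ->
  evalR p x = mcoeff mnm0 p + \sum_(j < n) x 0 j * mcoeff (mnm1 j) p.
Proof.
move=> hp; apply: (@complexI R); rewrite -evalC_toC evalC_affine//.
rewrite rmorphD rmorph_sum /=; congr (_ + _); apply: eq_bigr => j _.
by rewrite mxE rmorphM.
Qed.

Lemma evalR_mderiv_quadratic (R : realType) (n : nat) (g : {mpoly R[n]})
    (x : 'rV[R]_n) (j : 'I_n) :
  (mpoly.msize g <= 3)%N ->
  evalR (mderiv j g) x = gradient0 g 0 j + (x *m hessian g) 0 j.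
Proof.
move=> hg; rewrite evalR_affine ?msize_mderiv// !mxE; congr (_ + _).
by apply: eq_bigr => i _; rewrite !mxE mcoeff0_mderiv.
Qed.

Lemma evalR_quadratic (R : realType) (n : nat) (g : {mpoly R[n]}) (x : 'rV[R]_n) :
  (mpoly.msize g <= 3)%N ->
  2 * evalR g x = 2 * mcoeff mnm0 g + 2 * (x *m (gradient0 g)^T) 0 0 +
    (x *m hessian g *m x^T) 0 0.
Proof.
move=> hg.
have -> : 2 * evalR g x = 2 * mcoeff mnm0 g +
    \sum_(j < n) x 0 j * (evalR (mderiv j g) x + gradient0 g 0 j).
  have := evalC_euler2 (toC x) hg; rewrite evalC_toC.
  under eq_bigr => j _ do rewrite evalC_toC [toC x 0 j]mxE -rmorphD -rmorphM.
  set S := \sum_j _ => E; rewrite -mulr_natl -[X in _ = X + _]mulr_natl in E.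
  have {}E : (2 * evalR g x)%:C%C = (2 * mcoeff mnm0 g + \sum_(j < n) x 0 j *
      (evalR (mderiv j g) x + mcoeff mnm0 (mderiv j g)))%:C%C.
    rewrite [LHS]rmorphM [RHS]rmorphD [X in _ = X + _]rmorphM [X in _ = _ + X]rmorph_sum.
    by rewrite [_ 2]rmorph_nat.
  rewrite (complexI E).
  by congr (_ + _); apply: eq_bigr => j _; rewrite [gradient0 g 0 j]mxE.
rewrite -addrA; congr (_ + _); rewrite mulr_natl mulr2n !mxE -!big_split /=.
apply: eq_bigr => j _; rewrite evalR_mderiv_quadratic// [x^T _ _]mxE.
by rewrite [(gradient0 g)^T _ _]mxE; ring.
Qed.

Lemma hessian_sym (R : realType) (n : nat) (g : {mpoly R[n]}) :
  (hessian g)^T = hessian g.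
Proof. by apply/matrixP => i j; rewrite !mxE mderiv_comm. Qed.

Lemma quadratic_gt0_coef_ge0 (R : realFieldType) (a b q : R) :
  (forall t, 0 < a + t * b + t ^+ 2 * q) -> 0 <= q.
Proof.
move=> pos; rewrite leNgt; apply/negP => q0.
have a0 : 0 < a by have := pos 0; rewrite mul0r expr0n /= mul0r !addr0.
(* Averaging the values at [t] and [- t] removes [b]; for this [t] the average [a + t ^+ 2 * q]
   equals [q - t * a], which is negative. *)
pose t := 1 - a / q.
have aq : a / q < 0 by rewrite pmulr_rlt0// invr_lt0.
have tq : t * q = q - a by rewrite /t mulrBl mul1r divfK// lt_eqF.
have := pos t; have := pos (- t); rewrite sqrrN !expr2 -!mulrA tq => p1 p2.
have : 0 < a + t * (q - a) by lra.
by rewrite mulrBr tq; nra.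
Qed.

Lemma quadratic_ge0_linear_eq0 (R : realFieldType) (a q : R) :
  0 <= q -> (forall t, 0 <= t * a + t ^+ 2 * q) -> a = 0.
Proof.
(* The denominator [1 + q] stays positive when [q = 0], unlike that of the minimizer. *)
move=> q0 /(_ (- a / (1 + q))).
have q1 : 0 < 1 + q by lra.
have -> : - a / (1 + q) * a + (- a / (1 + q)) ^+ 2 * q = - (a / (1 + q)) ^+ 2.
  by field; rewrite gt_eqF.
rewrite oppr_ge0 => h; have := sqr_ge0 (a / (1 + q)); rewrite le_eqVlt => /orP[|/lt_le_trans/(_ h)].
  by rewrite eq_sym sqrf_eq0 mulf_eq0 invr_eq0 (gt_eqF q1) orbF => /eqP.
by rewrite ltxx.
Qed.

(** At [(s, y)] with [s] nonzero the form is [2 s ^+ 2 g(y / s)]. For [s = 0] it is the leading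
    coefficient of [2 g(t y)] in [t], which cannot be negative when [g] is positive on the whole
    line. *)
Lemma homog_quad_ge0 (R : realType) (n : nat) (g : {mpoly R[n]}) (X : 'rV[R]_(1 + n)) :
  (mpoly.msize g <= 3)%N -> (forall x : 'rV[R]_n, 0 < evalR g x) ->
  0 <= (X *m homog_quad g *m X^T) 0 0.
Proof.
move=> hg g_gt0; rewrite -[X]hsubmxK [lsubmx X]mx11_scalar.
move: (lsubmx X 0 0 : R) (rsubmx X) => s y.
rewrite tr_row_mx mul_row_block mul_row_col !mulmxDl.
have -> : (s%:M *m gradient0 g *m y^T) = s *: (y *m (gradient0 g)^T).
  by rewrite mul_scalar_mx -scalemxAl -[gradient0 g in LHS]trmxK -trmx_mul
    [y *m _]mx11_scalar tr_scalar_mx.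
rewrite tr_scalar_mx !mul_mx_scalar.
have -> : (s *: ((mcoeff mnm0 g *+ 2) *: s%:M) + s *: (y *m (gradient0 g)^T) +
    (s *: (y *m (gradient0 g)^T) + y *m hessian g *m y^T)) 0 0 =
    2 * mcoeff mnm0 g * s ^+ 2 + 2 * s * (y *m (gradient0 g)^T) 0 0 +
    (y *m hessian g *m y^T) 0 0.
  move: (y *m (gradient0 g)^T) (y *m hessian g *m y^T) => B Q.
  by rewrite !mxE eqxx mulr1n; ring.
set be := (y *m (gradient0 g)^T) 0 0; set q := (y *m hessian g *m y^T) 0 0.
have gE t : 2 * evalR g (t *: y) = 2 * mcoeff mnm0 g + 2 * (t * be) + t ^+ 2 * q.
  rewrite evalR_quadratic// linearZ /= -scalemxAr -!scalemxAl scalerA.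
  rewrite /be /q; move: (y *m (gradient0 g)^T) (y *m hessian g *m y^T) => B Q.
  by rewrite !mxE expr2.
have [->|s0] := eqVneq s 0.
  rewrite expr0n /= !mulr0 !mul0r !add0r.
  apply: (@quadratic_gt0_coef_ge0 R (2 * mcoeff mnm0 g) (2 * be)) => t.
  by rewrite mulrCA -gE mulr_gt0.
have -> : 2 * mcoeff mnm0 g * s ^+ 2 + 2 * s * be + q =
    s ^+ 2 * (2 * evalR g (s^-1 *: y)) by rewrite gE; field.
by rewrite mulr_ge0 ?sqr_ge0// mulr_ge0// ltW.
Qed.

(** A nondegenerate semidefinite form is definite: if it vanishes at [y], its linear term in [t] at
    [y + t z] with [z = y H] is twice the squared Euclidean norm of [z], so that [z = 0]. *)
Lemma hessian_form_gt0 (R : realType) (n : nat) (g : {mpoly R[n]}) (y : 'rV[R]_n) :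
  (mpoly.msize g <= 3)%N -> (forall x : 'rV[R]_n, 0 < evalR g x) ->
  \det (hessian g) != 0 -> y != 0 -> 0 < (y *m hessian g *m y^T) 0 0.
Proof.
move=> hg g_gt0 detH y0; set H := hessian g.
have Hge0 (x : 'rV[R]_n) : 0 <= (x *m H *m x^T) 0 0.
  have := homog_quad_ge0 (row_mx (0 : 'rV_1) x) hg g_gt0.
  by rewrite tr_row_mx mul_row_block mul_row_col !mul0mx trmx0 mulmx0 !add0r.
rewrite lt_neqAle Hge0 andbT eq_sym; apply: contra_neq y0 => qy0.
have HU : H \in unitmx by rewrite unitmxE unitfE.
apply: (can_inj (mulmxK HU)); rewrite mul0mx.
set z := y *m H.
have zz0 : 2 * (z *m z^T) 0 0 = 0.
  apply: (quadratic_ge0_linear_eq0 (Hge0 z)) => t.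
  have := Hge0 (y + t *: z).
  have -> : (y + t *: z) *m H *m (y + t *: z)^T =
     y *m H *m y^T + (t *: (z *m z^T) + t *: (z *m z^T)) + t ^+ 2 *: (z *m H *m z^T).
    have zHy : z *m H *m y^T = z *m z^T by rewrite -mulmxA {3}/z trmx_mul hessian_sym.
    rewrite linearD linearZ /= !mulmxDl !mulmxDr -!scalemxAl -!scalemxAr zHy -/z.
    by rewrite scalerA -expr2 !addrA.
  move: (y *m H *m y^T) qy0 (z *m z^T) (z *m H *m z^T) => A A0 B Q.
  rewrite !mxE A0 add0r => h; apply: le_trans h _.
  by rewrite le_eqVlt; apply/orP; left; apply/eqP; ring.
apply/rowP => j; rewrite [RHS]mxE; apply/eqP.
have : (z *m z^T) 0 0 = 0 by lra.
rewrite mxE => /eqP; rewrite psumr_eq0 => [|i _]; last by rewrite [z^T _ _]mxE -expr2 sqr_ge0.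
by move=> /allP/(_ j (mem_index_enum j)); rewrite [z^T _ _]mxE -expr2 sqrf_eq0.
Qed.

Lemma continuous_evalR (R : realType) (n : nat) (p : {mpoly R[n]}) :
  continuous (evalR p).
Proof.
have -> : evalR p = fun x : 'rV[R]_n =>
    \sum_(m <- msupp p) mcoeff m p * \prod_(i < n) x 0 i ^+ m i.
  by apply/funext => x; rewrite /evalR mevalE.
apply: continuous_big => [|m _]; first exact: add_continuous.
have prod_cont : continuous (fun x : 'rV[R]_n => \prod_(i < n) x 0 i ^+ m i).
  apply: (continuous_big (P := xpredT)) => [|i _]; first exact: mul_continuous.
  move=> x; apply: (@continuous_comp _ _ _ (fun y : 'rV[R]_n => y 0 i) (@GRing.exp R ^~ (m i))).
    exact: coord_continuous.
  exact: exprn_continuous.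
move=> x; apply: (@continuousM R _ (fun=> mcoeff m p)); last exact: prod_cont.
exact: cst_continuous.
Qed.

(** The constant is the minimum of the form on the compact unit sphere; homogeneity extends the
    bound to all vectors. *)
Lemma hessian_form_ge (R : realType) (n : nat) (g : {mpoly R[n]}) :
  (mpoly.msize g <= 3)%N -> (forall x : 'rV[R]_n, 0 < evalR g x) ->
  \det (hessian g) != 0 ->
  exists2 m : R, 0 < m &
    forall y : 'rV[R]_n, m * `|y| ^+ 2 <= (y *m hessian g *m y^T) 0 0.
Proof.
move=> hg g_gt0 detH; set q := fun y : 'rV[R]_n => (y *m hessian g *m y^T) 0 0.
(* This expression makes the continuity of [q] a consequence of that of [g]. *)
have qE y : q y = evalR g y + evalR g (- y) - 2 * mcoeff mnm0 g.
  have := evalR_quadratic y hg; have := evalR_quadratic (- y) hg.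
  rewrite linearN /= !mulNmx mulmxN opprK -/(q y).
  have -> : (- (y *m (gradient0 g)^T)) 0 0 = - (y *m (gradient0 g)^T) 0 0 by rewrite mxE.
  by move=> ? ?; lra.
have qZ t y : q (t *: y) = t ^+ 2 * q y.
  rewrite /q linearZ /= -scalemxAr -!scalemxAl scalerA.
  by move: (y *m _ *m _) => M; rewrite mxE expr2.
pose S := [set y : 'rV[R]_n | `|y| = 1].
(* An empty sphere leaves only the zero vector, for which any constant works. *)
have [S0|/set0P/negP/negPn/eqP S0] := pselect (S !=set0); last first.
  exists 1 => // y; have [->|y0] := eqVneq y 0.
    by rewrite normr0 expr0n /= mulr0 mul0mx mxE big1// => i _; rewrite !mxE mul0r.
  have : S (`|y|^-1 *: y).
    by rewrite /S /= normrZ normfV normr_id mulVf// normr_eq0.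
  by rewrite S0.
have Sc : compact S.
  apply: bounded_closed_compact.
    by exists 1; split => // M M1 y /= ->; exact: ltW.
  have /continuous_closedP norm_closed := @norm_continuous R 'rV[R]_n.
  exact: (norm_closed [set 1] (@closed_eq _ 1)).
have qc : {within S, continuous q}.
  apply: continuous_subspaceT => y.
  have -> : q = fun y => evalR g y + evalR g (- y) - 2 * mcoeff mnm0 g.
    by apply/funext => z; exact: qE.
  apply: (@continuousB _ _ _ (fun z => evalR g z + evalR g (- z)) (fun=> _)); last first.
    exact: cst_continuous.
  apply: (@continuousD _ _ _ (evalR g) (evalR g \o -%R)); first exact: continuous_evalR.
  apply: continuous_comp; [exact: opp_continuous | exact: continuous_evalR].
have [y0 /set_mem y0S y0min] := EVT_min_rV S0 Sc qc.
exists (q y0) => [|y].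
  by apply: hessian_form_gt0 => //; rewrite -normr_eq0 y0S oner_eq0.
have [->|yn0] := eqVneq y 0.
  by rewrite normr0 expr0n /= mulr0 mul0mx mxE big1// => i _; rewrite !mxE mul0r.
rewrite -/(q y).
have -> : q y = q (`|y|^-1 *: y) * `|y| ^+ 2.
  by rewrite qZ exprVn mulrAC mulVf ?mul1r// expf_neq0// normr_eq0.
rewrite ler_wpM2r ?sqr_ge0// y0min// inE /S /= normrZ normfV normr_id mulVf//.
by rewrite normr_eq0.
Qed.

(** * Existence *)

(** Fermat's rule at [t = 0] for psi restricted to a line, along which the forms are [p i + t * a i]
    and [g] is [q + t * b + t ^+ 2 * c]. *)
Lemma log_stationary (R : realType) (k : nat) (u p a : 'I_k -> R) (v q b c : R) :
  (forall i, 0 < p i) -> (forall t, 0 < q + t * b + t ^+ 2 * c) ->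
  (forall t, (forall i, 0 < p i + t * a i) ->
    \sum_i u i * ln (p i + t * a i) - v * ln (q + t * b + t ^+ 2 * c) <=
    \sum_i u i * ln (p i) - v * ln q) ->
  \sum_i u i * (a i / p i) = v * (b / q).
Proof.
move=> p_gt0 q_gt0 hmax.
pose h t := \sum_i u i * ln (p i + t * a i) - v * ln (q + t * b + t ^+ 2 * c).
have affine_derive (x y t : R) : is_derive t 1 (fun s => x + s * y) y.
  have -> : (fun s => x + s * y) = cst x + y \*: (@id R).
    by apply/funext => s; rewrite /GRing.scale /= mulrC.
  by apply: is_derive_eq; rewrite add0r /GRing.scale /= mulr1.
have h_derive t : (forall i, 0 < p i + t * a i) ->
    is_derive t 1 h (\sum_i u i * (a i / (p i + t * a i)) -
      v * ((b + 2 * t * c) / (q + t * b + t ^+ 2 * c))).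
  move=> pt.
  have ln1 i : is_derive t 1 (fun s => u i * ln (p i + s * a i))
      (u i * (a i / (p i + t * a i))).
    have D : is_derive t 1 (@ln R \o (fun s => p i + s * a i)) ((p i + t * a i)^-1 * a i).
      by apply: is_derive1_comp; exact: is_derive1_ln.
    have -> : (fun s => u i * ln (p i + s * a i)) = u i \*: (@ln R \o (fun s => p i + s * a i)).
      by [].
    by apply: is_derive_eq; rewrite [_^-1 * _]mulrC.
  have ln2 : is_derive t 1 (fun s => v * ln (q + s * b + s ^+ 2 * c))
      (v * ((b + 2 * t * c) / (q + t * b + t ^+ 2 * c))).
    have Dq : is_derive t 1 (fun s => q + s * b + s ^+ 2 * c) (b + 2 * t * c).
      have -> : (fun s => q + s * b + s ^+ 2 * c) =
          (fun s => q + s * b) + (c \*: (@GRing.exp R ^~ 2)).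
        by apply/funext => s; congr (_ + _); exact: mulrC.
      apply: is_derive_eq.
      by rewrite /GRing.scale /=; ring.
    have D : is_derive t 1 (@ln R \o (fun s => q + s * b + s ^+ 2 * c))
        ((q + t * b + t ^+ 2 * c)^-1 * (b + 2 * t * c)).
      by apply: is_derive1_comp; exact: is_derive1_ln.
    have -> : (fun s => v * ln (q + s * b + s ^+ 2 * c)) =
        v \*: (@ln R \o (fun s => q + s * b + s ^+ 2 * c)) by [].
    by apply: is_derive_eq; rewrite [_^-1 * _]mulrC.
  have -> : h = (\sum_(i < k) (fun s => u i * ln (p i + s * a i))) -
      (fun s => v * ln (q + s * b + s ^+ 2 * c)).
    by apply/funext => s; rewrite /h fctE fct_sumE.
  exact: is_deriveB.
(* Finitely many positivity conditions persist on an interval around 0. *)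
have [d d0 pd] : exists2 d : R, 0 < d & forall t, `|t| < d -> forall i, 0 < p i + t * a i.
  have : \forall t \near (0 : R), forall i, 0 < p i + t * a i.
    apply: (@filter_forall R 'I_k (fun i t => 0 < p i + t * a i) (nbhs (0 : R)) _) => i.
    have ct : (fun t : R => p i + t * a i) @ (0 : R) --> p i + 0 * a i.
      by have := @affine_derive (p i) (a i) 0 => -[/derivable1_diffP/differentiable_continuous].
    rewrite mul0r addr0 in ct.
    exact: (cvgr_gt _ ct).
  move=> /nbhs_ballP[d /= d0 bd]; exists d => // t td; apply: bd.
  by rewrite /ball /= sub0r normrN.
have h0 : is_derive (0 : R) 1 h 0.
  apply: (@derive1_at_max R h (- d) d 0).
  - by rewrite (le_trans _ (ltW d0))// oppr_le0 ltW.
  - by move=> t; rewrite in_itv /= -ltr_norml => /pd /h_derive [].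
  - by rewrite in_itv /= oppr_lt0 d0.
  - move=> t; rewrite in_itv /= -ltr_norml => /pd /hmax.
    rewrite {2}/h !mul0r !addr0 expr0n /= mul0r addr0.
    by under [X in _ -> _ <= X - _]eq_bigr => i _ do rewrite mul0r addr0.
have p0_gt0 i : 0 < p i + 0 * a i by rewrite mul0r addr0.
have h0' := @h_derive 0 p0_gt0.
have := @derive_val _ _ _ _ _ _ _ h0; rewrite (@derive_val _ _ _ _ _ _ _ h0').
rewrite mulr0 expr0n /= !mul0r !addr0 => /eqP; rewrite subr_eq0 => /eqP <-.
by apply: eq_bigr => i _; rewrite mul0r addr0.
Qed.

(** Bounds each [ln (f i)] by [ln (1 + |x|)] plus a constant, to be weighed against the growth of
    [ln g]. *)
Lemma evalR_affine_bound (R : realType) (n k : nat) (f : 'I_k -> {mpoly R[n]}) :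
  (forall i, mpoly.msize (f i) <= 2)%N ->
  exists2 D : R, 0 < D & forall i (x : 'rV[R]_n), `|evalR (f i) x| <= D * (1 + `|x|).
Proof.
move=> hf.
pose D i := `|mcoeff mnm0 (f i)| + \sum_(j < n) `|mcoeff (mnm1 j) (f i)|.
have D_ge0 i : 0 <= D i by rewrite addr_ge0// sumr_ge0.
exists (1 + \sum_i D i) => [|i x]; first by rewrite ltr_pwDl// sumr_ge0.
have x1 : 1 <= 1 + `|x| by rewrite lerDl.
apply: (@le_trans _ _ (D i * (1 + `|x|))); last first.
  rewrite ler_wpM2r ?(le_trans _ x1)// (bigD1 i)//= addrCA lerDl.
  by rewrite addr_ge0// sumr_ge0.
rewrite evalR_affine// (le_trans (ler_normD _ _))// mulrDl lerD//.
  by rewrite ler_peMr.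
rewrite (le_trans (ler_norm_sum _ _ _))// mulr_suml ler_sum// => j _.
rewrite normrM mulrC ler_wpM2l// (@le_trans _ _ `|x|)// ?lerDr//.
rewrite [leRHS]/Num.norm /= mx_normrE; apply/bigmax_geP; right => /=.
by exists (0, j).
Qed.

Lemma evalR_quadratic_bound (R : realType) (n : nat) (g : {mpoly R[n]}) :
  (mpoly.msize g <= 3)%N -> (forall x : 'rV[R]_n, 0 < evalR g x) ->
  \det (hessian g) != 0 ->
  exists2 m : R, 0 < m & forall x : 'rV[R]_n, m * (1 + `|x|) ^+ 2 <= evalR g x.
Proof.
move=> hg g_gt0 detH.
have [m m0 mH] := hessian_form_ge hg g_gt0 detH.
pose b := \sum_(j < n) `|gradient0 g 0 j|.
have b0 : 0 <= b by rewrite sumr_ge0.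
have far (x : 'rV[R]_n) : m / 2 * `|x| ^+ 2 - b * `|x| <= evalR g x.
  have := evalR_quadratic x hg; have := mH x.
  set q := (_ *m _ *m _) 0 0; set l := (x *m _) 0 0 => mq E.
  have lb : `|l| <= b * `|x|.
    rewrite /l mxE (le_trans (ler_norm_sum _ _ _))// mulr_suml ler_sum// => j _.
    rewrite [_^T j 0]mxE normrM mulrC ler_wpM2l//.
    rewrite [leRHS]/Num.norm /= mx_normrE; apply/bigmax_geP; right => /=.
    by exists (0, j).
  have c0 : 0 < mcoeff mnm0 g.
    have := g_gt0 0; have := evalR_quadratic (0 : 'rV[R]_n) hg.
    rewrite !mul0mx.
    have -> : (0 : 'M[R]_1) 0 0 = 0 by rewrite mxE.
    by move=> E0 g0; lra.
  have := ler_norm (- l); rewrite normrN => ?; lra.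
(* Beyond radius [B], [b |x|] is at most [m |x| ^+ 2 / 8] and [1 + |x|] at most [2 |x|], so that
   [far] gives the constant [m / 16]. Within it, the minimum of [g] on a compact ball gives [m2]. *)
pose B := 1 + 8 * b / m.
have B1 : 1 <= B by rewrite lerDl divr_ge0 ?mulr_ge0// ltW.
have B0 : 0 <= B := le_trans ler01 B1.
pose K := [set x : 'rV[R]_n | `|x| <= B].
have Kc : compact K.
  apply: bounded_closed_compact.
    by exists B; split => [|M BM x /= xB]; rewrite ?num_real//; apply: le_trans xB (ltW BM).
  have /continuous_closedP norm_closed := @norm_continuous R 'rV[R]_n.
  exact: (norm_closed [set r | r <= B] (@closed_le _ B)).
have K0 : K !=set0 by exists 0; rewrite /K /= normr0 (le_trans _ B1).
have [y _ ymin] := EVT_min_rV K0 Kc (continuous_subspaceT (@continuous_evalR R n g)).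
pose m2 := evalR g y / (1 + B) ^+ 2.
have m20 : 0 < m2 by rewrite divr_gt0 ?g_gt0// exprn_gt0//; lra.
exists (Num.min (m / 16) m2) => [|x]; first by rewrite lt_min m20 divr_gt0.
have [xB|xB] := leP `|x| B.
  apply: (@le_trans _ _ (m2 * (1 + B) ^+ 2)).
    rewrite ler_pM ?sqr_ge0 ?ge_min ?lexx ?orbT// ?le_min ?(ltW m20) ?divr_ge0 ?(ltW m0)//.
    by rewrite ler_sqr ?nnegrE ?lerD2l// addr_ge0.
  rewrite /m2 divfK ?ymin ?inE// gt_eqF// exprn_gt0//; lra.
apply: le_trans (far x).
apply: (@le_trans _ _ (m / 16 * (1 + `|x|) ^+ 2)).
  by rewrite ler_wpM2r ?sqr_ge0// ge_min lexx.
have bm : 8 * b <= m * `|x|.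
  rewrite -ler_pdivrMl// mulrC; apply: ltW; apply: le_lt_trans xB.
  by rewrite /B lerDr.
have x1 : 1 <= `|x| by apply: ltW; apply: le_lt_trans xB.
nra.
Qed.

Lemma evalR_affine_shift (R : realType) (n : nat) (p : {mpoly R[n]}) (y : 'rV[R]_n)
    (t : R) (j : 'I_n) :
  (mpoly.msize p <= 2)%N ->
  evalR p (y + t *: delta_mx 0 j) = evalR p y + t * mcoeff (mnm1 j) p.
Proof.
move=> hp; rewrite !evalR_affine// -addrA; congr (_ + _).
rewrite (bigD1 j)//= [in RHS](bigD1 j)//= !mxE !eqxx mulr1 mulrDl -!addrA; congr (_ + _).
rewrite addrC; congr (_ + _); apply: eq_bigr => l lj.
by rewrite !mxE (negbTE lj) andbF mulr0 addr0.
Qed.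

Lemma evalR_quadratic_shift (R : realType) (n : nat) (g : {mpoly R[n]}) (y : 'rV[R]_n)
    (t : R) (j : 'I_n) :
  (mpoly.msize g <= 3)%N ->
  evalR g (y + t *: delta_mx 0 j) =
  evalR g y + t * evalR (mderiv j g) y + t ^+ 2 * (hessian g j j / 2).
Proof.
move=> hg; rewrite evalR_mderiv_quadratic//.
have := evalR_quadratic (y + t *: delta_mx 0 j) hg; have := evalR_quadratic y hg.
set e := delta_mx 0 j; set H := hessian g.
have -> : (y + t *: e) *m H *m (y + t *: e)^T = y *m H *m y^T +
    (t *: (y *m H *m e^T) + t *: (y *m H *m e^T)) + t ^+ 2 *: (e *m H *m e^T).
  have eHy : e *m H *m y^T = y *m H *m e^T.
    rewrite [LHS]mx11_scalar -tr_scalar_mx -mx11_scalar !trmx_mul trmxK.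
    by rewrite hessian_sym mulmxA.
  rewrite linearD linearZ /= !mulmxDl !mulmxDr -!scalemxAl -!scalemxAr eHy.
  by rewrite scalerA -expr2 !addrA.
have -> : (y + t *: e) *m (gradient0 g)^T = y *m (gradient0 g)^T + t *: (gradient0 g *m e^T).
  rewrite mulmxDl -scalemxAl; congr (_ + _ *: _).
  by rewrite [RHS]mx11_scalar -tr_scalar_mx -mx11_scalar trmx_mul trmxK.
have colE (M : 'rV[R]_n) : (M *m e^T) 0 0 = M 0 j.
  rewrite mxE (bigD1 j)//= !mxE !eqxx mulr1 big1 ?addr0// => l lj.
  by rewrite !mxE (negbTE lj) mulr0.
have -> : (y *m H) 0 j = (y *m H *m e^T) 0 0 by rewrite colE.
have -> : gradient0 g 0 j = (gradient0 g *m e^T) 0 0 by rewrite colE.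
have -> : H j j = (e *m H *m e^T) 0 0 by rewrite colE /e -rowE [RHS]mxE.
move: (y *m H *m y^T) (y *m H *m e^T) (e *m H *m e^T) (y *m _^T) (_ *m e^T).
move=> A B E F G; rewrite !mxE => h1 h2; lra.
Qed.

(** The points of the cell where psi is at least [psi x0] lie in a compact set [K] on which the
    forms stay bounded away from 0, and psi is continuous on [K]. *)
Lemma exists_log_maximizer (R : realType) (n k : nat) (f : 'I_k -> {mpoly R[n]})
    (g : {mpoly R[n]}) (u : 'I_k -> R) (v : R) (x0 : 'rV[R]_n) :
  (forall i, mpoly.msize (f i) <= 2)%N -> (mpoly.msize g <= 3)%N ->
  (forall x : 'rV[R]_n, 0 < evalR g x) -> \det (hessian g) != 0 ->
  (forall i, 0 < u i) -> 0 < v -> \sum_i u i < 2 * v ->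
  (forall i, 0 < evalR (f i) x0) ->
  let psi x := \sum_i u i * ln (evalR (f i) x) - v * ln (evalR g x) in
  exists2 y, (forall i, 0 < evalR (f i) y) &
    forall x, (forall i, 0 < evalR (f i) x) -> psi x <= psi y.
Proof.
move=> hf hg g_gt0 detH u_gt0 v_gt0 uv f0 psi.
have [D D0 fD] := evalR_affine_bound hf.
have [m m0 gm] := evalR_quadratic_bound hg g_gt0 detH.
set U := \sum_i u i in uv.
(* The growth bounds give [psi x <= K0 - (2 v - U) rho x]; solving for [rho x] yields the radius
   [expR Lam]. *)
pose K0 := U * ln D - v * ln m.
pose rho (x : 'rV[R]_n) := ln (1 + `|x|).
have r0 (x : 'rV[R]_n) : 0 < 1 + `|x| by rewrite ltr_pwDl.
have rho_ge0 x : 0 <= rho x by rewrite ln_ge0// lerDl.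
have lnf x i : 0 < evalR (f i) x -> ln (evalR (f i) x) <= ln D + rho x.
  move=> fx; rewrite -lnM ?posrE// ler_ln ?posrE ?mulr_gt0//.
  exact: le_trans (ler_norm _) (fD _ _).
have lng x : ln m + 2 * rho x <= ln (evalR g x).
  have -> : 2 * rho x = ln ((1 + `|x|) ^+ 2) by rewrite lnXn// mulr_natl.
  by rewrite -lnM ?posrE ?exprn_gt0// ler_ln ?posrE ?mulr_gt0 ?exprn_gt0.
pose Lam := (K0 - psi x0) / (2 * v - U).
(* This comes from bounding all terms of psi except that of [f i]; what remains in [rho x] has a
   favorable sign. *)
pose eps i := expR (ln D + (psi x0 - K0) / u i).
pose K := [set x : 'rV[R]_n | `|x| <= expR Lam] `&`
  \bigcap_(i in [set: 'I_k]) [set x | eps i <= evalR (f i) x].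
have superK x : (forall i, 0 < evalR (f i) x) -> psi x0 <= psi x -> K x.
  move=> fx px; split => [/=|i _ /=].
    have /ltW : `|x| < 1 + `|x| by rewrite ltrDr.
    move=> /le_trans; apply; rewrite -[leLHS]lnK ?posrE// ler_expR -/(rho x).
    rewrite ler_pdivlMr ?subr_gt0//.
    have : \sum_i u i * ln (evalR (f i) x) <= U * (ln D + rho x).
      by rewrite mulr_suml ler_sum// => i _; rewrite ler_wpM2l ?lnf// ltW.
    have : v * (ln m + 2 * rho x) <= v * ln (evalR g x) by rewrite ler_wpM2l// ltW.
    move: px; rewrite /psi /K0; nra.
  rewrite -[leRHS]lnK ?posrE// ler_expR -lerBrDl ler_pdivrMr//.
  have : \sum_(l | l != i) u l * ln (evalR (f l) x) <=
      (U - u i) * (ln D + rho x).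
    rewrite /U [X in _ <= (X - _) * _](bigD1 i)//= addrAC subrr add0r mulr_suml.
    by rewrite ler_sum// => l _; rewrite ler_wpM2l ?lnf// ltW.
  have : v * (ln m + 2 * rho x) <= v * ln (evalR g x) by rewrite ler_wpM2l// ltW.
  have : 0 <= (2 * v - U) * rho x by rewrite mulr_ge0// subr_ge0 ltW.
  have : 0 <= u i * rho x by rewrite mulr_ge0// ltW.
  move: px; rewrite {2}/psi (bigD1 i)//= /K0; nra.
have Kpos x : K x -> forall i, 0 < evalR (f i) x.
  by move=> [_ Kx] i; apply: lt_le_trans (Kx i I); rewrite expR_gt0.
have Kc : compact K.
  apply: bounded_closed_compact.
    exists (expR Lam); split => [|M LM x [/= xB _]]; rewrite ?num_real//.
    exact: le_trans xB (ltW LM).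
  apply: closedI.
    have /continuous_closedP norm_closed := @norm_continuous R 'rV[R]_n.
    exact: (norm_closed [set r | r <= expR Lam] (@closed_le _ _)).
  apply: closed_bigI => i _.
  have /continuous_closedP f_closed := @continuous_evalR R n (f i).
  exact: (f_closed [set r | eps i <= r] (@closed_ge _ _)).
have Kx0 : K x0 by exact: superK.
have psic : {within K, continuous psi}.
  apply: continuous_in_subspaceT => x /set_mem /Kpos fx.
  have lnc p : 0 < evalR p x -> {for x, continuous (fun z => ln (evalR p z))}.
    move=> px; apply: (@continuous_comp _ _ _ (evalR p) (@ln R)).
      exact: continuous_evalR.
    exact: continuous_ln.
  apply: (@continuousB _ _ _ (fun z => \sum_i u i * ln (evalR (f i) z))
    (fun z => v * ln (evalR g z))).
    have ulnc i : {for x, continuous (fun z => u i * ln (evalR (f i) z))}.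
      apply: (@continuousM R _ (fun=> u i)); first exact: cst_continuous.
      exact: lnc.
    exact: (@cvg_big R 'I_k +%R 0 xpredT (@add_continuous _) _ (nbhs x) _ _ _
      (nbhs_filter x) (fun i _ => ulnc i)).
  apply: (@continuousM R _ (fun=> v)); first exact: cst_continuous.
  exact: lnc.
have [y /set_mem Ky ymax] := EVT_max_rV (ex_intro _ x0 Kx0) Kc psic.
exists y => [|x fx]; first exact: Kpos.
have [px|/ltW px] := leP (psi x0) (psi x); first by rewrite ymax ?inE//; exact: superK.
by rewrite (le_trans px)// ymax ?inE.
Qed.

Lemma exists_critical_point (R : realType) (n k : nat) (f : 'I_k -> {mpoly R[n]})
    (g : {mpoly R[n]}) (u : 'I_k -> R) (v : R) (x0 : 'rV[R]_n) :
  (forall i, mpoly.msize (f i) <= 2)%N -> (mpoly.msize g <= 3)%N ->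
  (forall x : 'rV[R]_n, 0 < evalR g x) -> \det (hessian g) != 0 ->
  (forall i, 0 < u i) -> 0 < v -> \sum_i u i < 2 * v ->
  (forall i, 0 < evalR (f i) x0) ->
  exists2 y, (forall i, 0 < evalR (f i) y) & critical_point f g u v (toC y).
Proof.
move=> hf hg g_gt0 detH u_gt0 v_gt0 uv f0.
have [y fy ymax] := exists_log_maximizer hf hg g_gt0 detH u_gt0 v_gt0 uv f0.
exists y => //; split => [|j].
  rewrite evalC_toC mulf_neq0 ?fmorph_eq0 ?(gt_eqF (g_gt0 _))//.
  by apply/prodf_neq0 => i _; rewrite evalC_toC fmorph_eq0 gt_eqF.
(* [y] is maximal along the coordinate line in direction [j], on which each [f i] is affine and [g]
   has leading coefficient half the diagonal entry of the Hessian. *)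
have crit : \sum_i u i * (mcoeff (mnm1 j) (f i) / evalR (f i) y) =
    v * (evalR (mderiv j g) y / evalR g y).
  apply: (@log_stationary R k u _ _ v _ _ (hessian g j j / 2)) => // t.
    by rewrite -evalR_quadratic_shift.
  move=> ft; rewrite -evalR_quadratic_shift//.
  under eq_bigr => i _ do rewrite -evalR_affine_shift//.
  by apply: ymax => i; rewrite evalR_affine_shift.
apply/eqP; rewrite subr_eq0; apply/eqP.
rewrite !evalC_toC mulrAC -mulrA -fmorphV -!rmorphM -crit rmorph_sum.
apply: eq_bigr => i _; rewrite evalC_toC evalC_mderiv_affine//.
by rewrite -fmorphV -!rmorphM mulrAC mulrA.
Qed.

(** * Regions and uniqueness *)

Lemma evalR_affine_segment (R : realType) (n : nat) (p : {mpoly R[n]}) (x y : 'rV[R]_n)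
    (t : R) :
  (mpoly.msize p <= 2)%N ->
  evalR p (x + t *: (y - x)) = (1 - t) * evalR p x + t * evalR p y.
Proof.
move=> hp; rewrite !evalR_affine// !mulrDr addrACA -mulrDl subrK mul1r; congr (_ + _).
by rewrite !mulr_sumr -big_split; apply: eq_bigr => j _; rewrite !mxE /=; ring.
Qed.

(** A form that changes sign on a connected set vanishes on it by the intermediate value theorem;
    conversely, the segment between two points with equal signs avoids all hyperplanes. *)
Lemma region_signs (R : realType) (n k : nat) (f : 'I_k -> {mpoly R[n]}) (x : 'rV[R]_n) :
  (forall i, mpoly.msize (f i) <= 2)%N -> arr_complement f x ->
  connected_component (arr_complement f) x =
  [set y | forall i, 0 < evalR (f i) x * evalR (f i) y].
Proof.
move=> hf fx.
have nz y i : arr_complement f y -> evalR (f i) y != 0.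
  by move=> fy; apply/eqP => fy0; apply: fy; exists i.
apply/seteqP; split => [y [B [Bx BU Bc] By] i|y /= fxy].
  have nzxy : evalR (f i) x * evalR (f i) y != 0.
    by rewrite mulf_neq0// nz//; exact: BU.
  rewrite lt_neqAle eq_sym nzxy leNgt; apply/negP => fxy.
  have /connected_intervalP fB : connected (evalR (f i) @` B).
    apply: connected_continuous_connected => //.
    by apply: continuous_subspaceT; exact: continuous_evalR.
  have [z Bz fz] : (evalR (f i) @` B) 0.
    have [fx0|fx0] := ltP (evalR (f i) x) 0.
      apply: (fB (evalR (f i) x) (evalR (f i) y)); [by exists x|by exists y|].
      by rewrite (ltW fx0)/= ltW// -(nmulr_rlt0 _ fx0).
    apply: (fB (evalR (f i) y) (evalR (f i) x)); [by exists y|by exists x|].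
    rewrite fx0 andbT ltW// -(pmulr_rlt0 (evalR (f i) y) (x := evalR (f i) x))//.
    by rewrite lt_neqAle eq_sym nz.
  by have := nz z i (BU z Bz); rewrite fz eqxx.
pose gam (t : R) := x + t *: (y - x).
exists (gam @` `[0, 1]%classic); last first.
  by exists 1; rewrite /= ?in_itv /= ?lexx ?ler01// /gam scale1r addrCA subrr addr0.
split.
- by exists 0; rewrite /= ?in_itv /= ?lexx ?ler01// /gam scale0r addr0.
- move=> _ [t /= + <-] [i _]; rewrite in_itv /= => /andP[t0 t1].
  rewrite /hyperplane /= /gam evalR_affine_segment// => f0.
  have := fxy i; have := nz x i fx.
  (* Multiplied by its value at [x], the form is a convex combination of two positive numbers. *)
  have : evalR (f i) x * ((1 - t) * evalR (f i) x + t * evalR (f i) y) = 0.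
    by rewrite f0 mulr0.
  rewrite mulrDr mulrCA -expr2 [X in _ + X]mulrCA -sqrf_eq0.
  move: (_ * evalR (f i) y) (evalR (f i) x ^+ 2) (sqr_ge0 (evalR (f i) x)) => a b b0.
  rewrite le_eqVlt eq_sym in b0; move=> E /negbTE bn a0; rewrite bn /= in b0.
  have [t00|t00] := eqVneq t 0; first by move: E; rewrite t00; lra.
  have : 0 < t * a by rewrite mulr_gt0// lt_neqAle eq_sym t00.
  have : 0 <= (1 - t) * b by rewrite mulr_ge0 ?subr_ge0// ltW.
  lra.
- apply: connected_continuous_connected; first exact: segment_connected.
  apply: continuous_subspaceT => t.
  apply: cvgD; first exact: cst_continuous.
  exact: scalel_continuous.
Qed.

(** The form at infinity forces coordinate 0 to vanish; the normals, of rank [n], then force the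
    others. *)
Lemma homog_forms_inj (R : realType) (n k : nat) (f : 'I_k -> {mpoly R[n]}) (d : 'rV[R]_(1 + n)) :
  essential f -> d *m (homog_forms f)^T = 0 -> d = 0.
Proof.
move=> f_ess dA.
have : row_mx (lsubmx d) (rsubmx d) *m (homog_forms f)^T = row_mx 0 0.
  by rewrite hsubmxK dA row_mx0.
rewrite tr_block_mx mul_row_block trmx1 trmx0 mulmx1 mulmx0 addr0.
move=> /eq_row_mx[d0]; rewrite d0 mul0mx add0r => dn.
rewrite -[d]hsubmxK d0.
have nf : row_free (normals f)^T by rewrite /row_free mxrank_tr f_ess.
suff -> : rsubmx d = 0 by rewrite row_mx0.
by apply/eqP; rewrite -(mulmx_free_eq0 _ nf) dn.
Qed.

Lemma homog_weights_gt0 (R : realType) (k : nat) (u : 'I_k -> R) (v : R) i :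
  (forall i, 0 < u i) -> \sum_i u i < 2 * v -> 0 < homog_weights u v 0 i.
Proof.
move=> u_gt0 uv; rewrite /homog_weights; case: (split_ordP i) => l ->.
  by rewrite row_mxEl !mxE ord1 eqxx mulr1n subr_gt0.
by rewrite row_mxEr mxE.
Qed.

(** The lift [X] of [z] is compared with its conjugate: the difference is [2 i] times the imaginary
    part, and each product of values is a squared modulus. *)
Lemma critical_point_real (R : realType) (n k : nat) (f : 'I_k -> {mpoly R[n]})
    (g : {mpoly R[n]}) (u : 'I_k -> R) (v : R) (z : 'rV[complex R]_n) :
  (forall i, mpoly.msize (f i) <= 2)%N -> essential f -> (mpoly.msize g <= 3)%N ->
  (forall x : 'rV[R]_n, 0 < evalR g x) ->
  (forall i, 0 < u i) -> 0 < v -> \sum_i u i < 2 * v ->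
  critical_point f g u v z -> exists x : 'rV[R]_n, z = toC x.
Proof.
move=> hf f_ess hg g_gt0 u_gt0 v_gt0 uv crit.
have [nz _] := crit.
move: nz; rewrite mulf_eq0 negb_or => /andP[gz0 /prodf_neq0 fz0].
pose C := real_complex R.
pose mu := sqrtc (C v / evalC g z).
have mu2 : mu ^+ 2 = C v / evalC g z by exact: sqr_sqrtc.
have mu0 : mu != 0.
  by rewrite -sqrf_eq0 mu2 mulf_neq0 ?invr_eq0// fmorph_eq0 gt_eqF.
have sX := critical_point_homog hf hg crit mu0 mu2.
set X := row_mx mu%:M (mu *: z) in sX.
pose cj := @conjc R.
have cjA (l m : nat) (M : 'M[R]_(l, m)) : map_mx cj (map_mx C M) = map_mx C M.
  by apply/matrixP => i j; rewrite !mxE; exact: conjc_real.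
have FcX : map_mx cj X *m (map_mx C (homog_forms f))^T =
    map_mx cj (X *m (map_mx C (homog_forms f))^T).
  by rewrite map_mxM map_trmx cjA.
have FX0 i : (X *m (map_mx C (homog_forms f))^T) 0 i != 0.
  rewrite homog_formsE//; case: (split_ordP i) => l ->.
    by rewrite row_mxEl !mxE ord1 eqxx mulr1n.
  by rewrite row_mxEr !mxE; apply: mulf_neq0; [exact: mu0|exact: fz0].
have d0 : map_mx (@complex.Im R) X = 0.
  apply: (@stationary_unique _ _ _ (homog_forms f) (homog_quad g)
    (homog_weights u v 0) X (map_mx cj X) (2 * 'i%C)) => //.
  - by move=> x; exact: homog_quad_ge0.
  - by move=> x; exact: homog_forms_inj.
  - by move=> i; exact: homog_weights_gt0.
  (* The data are real, so that conjugating the equation of [X] gives that of its conjugate. *)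
  - rewrite -/C FcX -[map_mx C (homog_quad g)]cjA -map_mxM -sX map_mxM cjA.
    congr (_ *m _); apply/rowP => i.
    move: (X *m (map_mx C (homog_forms f))^T) (homog_weights u v) => F W.
    by rewrite !mxE [RHS]rmorphM /= fmorphV [X in _ = X / _]conjc_real.
  - by rewrite mulf_neq0 ?pnatr_eq0// -sqrf_eq0 sqr_i oppr_eq0 oner_eq0.
  - by apply/matrixP => i j; rewrite !mxE subcJ mulrAC.
  - move=> i; rewrite -/C FcX [X in _ * X]mxE -sqr_normc exprn_gt0// normr_gt0.
    exact: FX0.
(* Both [mu] and the [mu * z 0 j] are real, and [z] is recovered as their quotient. *)
have muR : mu = C (complex.Re mu).
  have /matrixP/(_ 0 (lshift n 0)) := d0; rewrite mxE row_mxEl !mxE /= mulr1n.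
  by move=> Imu; apply/eqP; rewrite eq_complex /= Imu !eqxx.
exists (\row_j (complex.Re (mu * z 0 j) / complex.Re mu)).
apply/rowP => j; rewrite !mxE.
have /matrixP/(_ 0 (rshift 1 j)) := d0; rewrite mxE row_mxEr !mxE /= => Imz.
apply: (mulfI mu0); rewrite {2}muR -rmorphM /= mulrCA divff ?mulr1.
  by apply/eqP; rewrite eq_complex /= Imz !eqxx.
by apply: contraNneq mu0 => Re0; rewrite muR Re0 /C rmorph0.
Qed.

(** With the positive square roots [nu], the lifts of [x] and [y] give every homogenized form the
    same sign, so that they coincide; coordinate 0 then identifies the scalars. *)
Lemma critical_point_unique (R : realType) (n k : nat) (f : 'I_k -> {mpoly R[n]})
    (g : {mpoly R[n]}) (u : 'I_k -> R) (v : R) (x y : 'rV[R]_n) :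
  (forall i, mpoly.msize (f i) <= 2)%N -> essential f -> (mpoly.msize g <= 3)%N ->
  (forall x : 'rV[R]_n, 0 < evalR g x) ->
  (forall i, 0 < u i) -> 0 < v -> \sum_i u i < 2 * v ->
  critical_point f g u v (toC x) -> critical_point f g u v (toC y) ->
  (forall i, 0 < evalR (f i) x * evalR (f i) y) -> x = y.
Proof.
move=> hf f_ess hg g_gt0 u_gt0 v_gt0 uv critx crity fxy.
pose C := real_complex R.
pose nu w := Num.sqrt (v / evalR g w).
have nu_gt0 w : 0 < nu w by rewrite sqrtr_gt0 divr_gt0.
have nu0 w : C (nu w) != 0 by rewrite fmorph_eq0 gt_eqF.
have nu2 w : C (nu w) ^+ 2 = C v / evalC g (toC w).
  by rewrite -rmorphXn /= sqr_sqrtr ?divr_ge0// ?ltW// evalC_toC rmorphM fmorphV.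
have sX := critical_point_homog hf hg critx (nu0 x) (nu2 x).
have sY := critical_point_homog hf hg crity (nu0 y) (nu2 y).
have d0 : row_mx (nu x - nu y)%:M (nu x *: x - nu y *: y) = 0 :> 'rV_(1 + n).
  apply: (stationary_unique _ _ _ sX sY (oner_neq0 _)).
  - by move=> w; exact: homog_quad_ge0.
  - by move=> w; exact: homog_forms_inj.
  - by move=> i; exact: homog_weights_gt0.
  - rewrite scale1r opp_row_mx add_row_mx map_row_mx; congr row_mx.
      by rewrite map_scalar_mx rmorphB raddfB.
    by apply/rowP => j; rewrite !mxE rmorphB !rmorphM.
  - move=> i; rewrite !(homog_formsE _ _ hf); case: (split_ordP i) => l ->.
      by rewrite !row_mxEl !mxE ord1 eqxx !mulr1n -rmorphM ltcR mulr_gt0.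
    rewrite !row_mxEr !mxE !evalC_toC -!rmorphM ltcR mulrACA.
    by rewrite mulr_gt0// mulr_gt0.
rewrite -row_mx0 in d0; move/eq_row_mx: d0 => [/matrixP/(_ 0 0)].
rewrite !mxE eqxx mulr1n => /subr0_eq -> /subr0_eq.
by apply: scalerI; rewrite gt_eqF.
Qed.

(** * Genericity *)

Lemma mdeg_mnm1D (n : nat) (i j : 'I_n) : (mdeg (mnm_add (mnm1 i) (mnm1 j)) < 3)%N.
Proof. by rewrite mdegD !mdeg1. Qed.

(** The factor is 2 on the diagonal and 1 elsewhere, as in the second derivatives of [x_i x_j]. *)
Definition hessian_poly (R : realType) (n : nat) (i j : 'I_n) :
    {mpoly R[#|{: bmultinom n 3}|]} :=
  mpolyX R (mnm1 (enum_rank (BMultinom (mdeg_mnm1D i j)))) *+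
    ((mnm1 i : multinom n) j).+1.

Lemma meval_hessian_poly (R : realType) (n : nat) (g : {mpoly R[n]}) (i j : 'I_n) :
  meval (coefs2 g) (hessian_poly R i j) = hessian g i j.
Proof.
rewrite /hessian_poly mevalMn mevalXU mxE mcoeff0_mderiv mcoeff_deriv.
by rewrite /coefs2 enum_rankK.
Qed.

(** Provides a polynomial outside the degenerate locus, since the determinant is a power of 2. *)
Lemma hessian_sum_sqr (R : realType) (n : nat) :
  hessian (\sum_(l < n) mpolyX R (mnm_add (mnm1 l) (mnm1 l))) = 2%:M.
Proof.
apply/matrixP => i j; rewrite !mxE mcoeff0_mderiv.
have -> : mderiv j (\sum_(l < n) mpolyX R (mnm_add (mnm1 l) (mnm1 l))) =
    2 *: mpolyX R (mnm1 j).
  rewrite raddf_sum /= (bigD1 j)//= big1 ?addr0 => [|l lj].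
    by rewrite mderivX mnmDE mnm1E eqxx addmK.
  by rewrite mderivX mnmDE mnm1E (negbTE lj) scale0r.
by rewrite mcoeffZ mcoeffX eq_mnm1 mulr_natr eq_sym.
Qed.

(** One equation suffices: the determinant of the matrix of the [hessian_poly], since evaluation
    commutes with determinants. *)
Lemma zariski_closed2_det_hessian (R : realType) (n : nat) :
  zariski_closed2 [set g : {mpoly R[n]} | deg_le2 g /\ \det (hessian g) = 0].
Proof.
exists [set \det (\matrix_(i, j) hessian_poly R i j)].
have detE (g : {mpoly R[n]}) :
    meval (coefs2 g) (\det (\matrix_(i, j) hessian_poly R i j)) = \det (hessian g).
  rewrite -det_map_mx; congr (\det _); apply/matrixP => i j.
  by rewrite -meval_hessian_poly !mxE.
apply/seteqP; split => g /= [dg hg]; split => //.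
  by move=> P ->; rewrite detE.
by rewrite -detE; exact: hg.
Qed.

Lemma det_hessian_proper (R : realType) (n : nat) :
  [set g : {mpoly R[n]} | deg_le2 g /\ \det (hessian g) = 0] `<` @deg_le2 R n.
Proof.
split => [g []//|].
move=> /(_ (\sum_(l < n) mpolyX R (mnm_add (mnm1 l) (mnm1 l)))) /= h.
have /h[_ /eqP] : deg_le2 (\sum_(l < n) mpolyX R (mnm_add (mnm1 l) (mnm1 l))).
  apply: leq_trans (mmeasure_sum _ _ _ _) _.
  by apply/bigmax_leqP => l _; rewrite msizeX mdegD !mdeg1.
by rewrite hessian_sum_sqr det_scalar expf_eq0 pnatr_eq0 andbF.
Qed.

(** * Rescaling of the forms and conclusion *)

(** Rescaling the forms only adds a constant to psi. This reduces any region to the one where all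
    forms are positive. *)
Lemma critical_point_scale (R : realType) (n k : nat) (f : 'I_k -> {mpoly R[n]})
    (g : {mpoly R[n]}) (u s : 'I_k -> R) (v : R) (z : 'rV[complex R]_n) :
  (forall i, s i != 0) ->
  critical_point (fun i => s i *: f i) g u v z -> critical_point f g u v z.
Proof.
move=> s0 [nz crit].
have evalCZ c p : evalC (c *: p) z = real_complex R c * evalC p z.
  by rewrite /evalC map_mpolyZ mevalZ.
have Cs0 i : real_complex R (s i) != 0 by rewrite fmorph_eq0.
split => [|j].
  apply: contraNneq nz => nz; under eq_bigr => i _ do rewrite evalCZ.
  by rewrite big_split /= mulrCA nz mulr0.
have /subr0_eq E := crit j.
apply/eqP; rewrite subr_eq0; apply/eqP; apply: (etrans _ E).
apply: eq_bigr => i _.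
rewrite mderivZ !evalCZ invfM; move: (Cs0 i).
move: (real_complex R (s i)) (evalC (f i) z)^-1 (evalC (mderiv j (f i)) z) => c a b c0.
by rewrite -!mulrA [c^-1 * _]mulrCA mulKf.
Qed.

Theorem theorem1p2 (R : realType) (n k : nat) (f : 'I_k -> {mpoly R[n]})
    (f_deg1 : forall i, has_degree 1 (f i)) (f_ess : essential f) :
  exists Z : set {mpoly R[n]},
    [/\ zariski_closed2 Z, Z `<` @deg_le2 R n &
        forall g : {mpoly R[n]}, has_degree 2 g ->
          (forall x : 'rV[R]_n, 0 < evalR g x) -> ~ Z g ->
        forall (u : 'I_k -> R) (v : R),
          (forall i, 0 < u i) -> 0 < v -> \sum_(i < k) u i < 2 * v ->
        (forall z : 'rV[complex R]_n, critical_point f g u v z ->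
           exists x : 'rV[R]_n, z = toC x) /\
        (forall C : set 'rV[R]_n, is_region f C ->
           exists! x : 'rV[R]_n, C x /\ critical_point f g u v (toC x))].
Proof.
exists [set g : {mpoly R[n]} | deg_le2 g /\ \det (hessian g) = 0]; split.
- exact: zariski_closed2_det_hessian.
- exact: det_hessian_proper.
move=> g g_deg2 g_gt0 Zg u v u_gt0 v_gt0 uv.
have hf i : (mpoly.msize (f i) <= 2)%N by rewrite f_deg1.
have hg : (mpoly.msize g <= 3)%N by rewrite g_deg2.
have detH : \det (hessian g) != 0 by apply/eqP => detH; apply: Zg.
split => [z|C [x fx ->]]; first exact: critical_point_real.
rewrite region_signs//.
have fx0 i : evalR (f i) x != 0 by apply/eqP => fx0; apply: fx; exists i.
have evalRZ c (p : {mpoly R[n]}) w : evalR (c *: p) w = c * evalR p w.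
  by rewrite /evalR mevalZ.
(* Scaling [f i] by its value at [x] makes all forms positive at [x], and their positive cell is the
   region of [x]. *)
have [||y fy crity] := @exists_critical_point R n k
    (fun i => evalR (f i) x *: f i) g u v x _ hg g_gt0 detH u_gt0 v_gt0 uv.
- by move=> i; exact: leq_trans (msizeZ_le _ _) (hf i).
- by move=> i; rewrite evalRZ -expr2 lt_neqAle eq_sym sqrf_eq0 fx0 sqr_ge0.
have crit_y := critical_point_scale fx0 crity.
have fxy i : 0 < evalR (f i) x * evalR (f i) y by rewrite -evalRZ.
exists y; split => [//|w [/= fxw critw]].
apply: (critical_point_unique hf f_ess hg g_gt0 u_gt0 v_gt0 uv crit_y critw) => i.
(* Both [y] and [w] have the signs of [x]; dividing by the square of the value at [x] compares them
   with each other. *)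
have := mulr_gt0 (fxy i) (fxw i); rewrite mulrACA -expr2 pmulr_rgt0//.
by rewrite lt_neqAle eq_sym sqrf_eq0 fx0 sqr_ge0.
Qed.
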